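(* Let $(z_{\mathcal{E}},\lambda_{\mathcal{E}})$ be a KKT pair up to $\mathcal{E}$ of (RMP) and consider the dual problem (RMD) with respect to $(z_{\mathcal{E}},\lambda_{\mathcal{E}})$. If $(f,g)$ is generalized convex on $S$ at every $y\in S$, then $(z_{\mathcal{E}},\lambda_{\mathcal{E}})$ is an $\mathcal{E}$-quasi Pareto solution of (RMD).
   Context: Setting. $\mathbb{R}^n$ carries the Euclidean norm $\|\cdot\|$; $\mathbb{B}$ is its closed unit ball and $B(x,\rho)$ the open ball. $I=\{1,\ldots,m\}$, $J=\{1,\ldots,p\}$. $\mathcal{K}_c$ is the set of closed bounded intervals $[a^L,a^U]$, $a^L\le a^U$. $S\subset\mathbb{R}^n$ is nonempty and closed. For $i\in I$, $f_i(x)=[f_i^L(x),f_i^U(x)]\in\mathcal{K}_c$, where $f_i^L,f_i^U:\mathbb{R}^n\to\mathbb{R}$ are locally Lipschitz with $f_i^L(x)\le f_i^U(x)$; $f:=(f_1,\ldots,f_m)$. For $j\in J$, $\mathcal{V}_j\subset\mathbb{R}^{n_j}$ is nonempty compact and $g_j:\mathbb{R}^n\times\mathbb{R}^{n_j}\to\mathbb{R}$. Put $g_j(x):=\max_{v_j\in\mathcal{V}_j}g_j(x,v_j)$, $\mathcal{V}_j(x):=\{v_j\in\mathcal{V}_j: g_j(x,v_j)=g_j(x)\}$ and $g:=(g_1,\ldots,g_p)$. Standing conditions on $g_j$: for every $\bar x\in\mathbb{R}^n$ and $j\in J$ there is $\delta>0$ such that (a) $v_j\in\mathcal{V}_j\mapsto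 g_j(x,v_j)$ is upper semicontinuous for each $x\in B(\bar x,\delta)$, and the functions $g_j(\cdot,v_j)$, $v_j\in\mathcal{V}_j$, are Lipschitz on $B(\bar x,\delta)$ with a common constant $K_j$; (b) the multifunction $(x,v_j)\in B(\bar x,\delta)\times\mathcal{V}_j\rightrightarrows\partial_x g_j(x,v_j)$ is closed at $(\bar x,\bar v_j)$ for each $\bar v_j\in\mathcal{V}_j(\bar x)$ (i.e. if $(x^k,v^k)\to(\bar x,\bar v_j)$, $x_k^*\in\partial_x g_j(x^k,v^k)$, $x_k^*\to x^*$, then $x^*\in\partial_x g_j(\bar x,\bar v_j)$). $N(x;S)$ is the limiting (Mordukhovich) normal cone to $S$ at $x$; $\partial$ is the limiting (Mordukhovich) subdifferential, $\partial_x$ the limiting subdifferential in the variable $x$; $\mathrm{co}$ denotes convex hull; $C^\circ:=\{x^*:\langle x^*,x\rangle\le0\ \forall x\in C\}$ is the polar cone. Fix reals $0\le\epsilon_i^L\le\epsilon_i^U$, $i\in I$, with $\theta:=\sum_{i\in I}(\epsilon_i^L+\epsilon_i^U)>0$. Put $\mathcal{E}_i:=[\epsilon_i^L,\epsilon_i^U]$, $\mathcal{E}:=(\mathcal{E}_1,\ldots,\mathcal{E}_m)$. (RMP) is the problem of minimizing $f$ (in the order $\le_{LU}$ componentwise) over $\Omega:=\{x\in S: g_j(x,v_j)\le0\ \forall v_j\in\mathcal{V}_j,\ \forall j\in J\}$. Put $\Omega_{\mathcal{E}}:=\{x\in S: g_j(x)\le\sqrt{\theta},\ j\in J\}$. Intervals: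 $[a^L,a^U]-[b^L,b^U]=[a^L-b^U,a^U-b^L]$; $k[a^L,a^U]=[ka^L,ka^U]$ for $k\ge0$; $A\ge_{LU}B$ iff $a^L\ge b^L$ and $a^U\ge b^U$; $A>_{LU}B$ iff $A\ge_{LU}B$ and $A\ne B$. A pair $(z,\lambda)\in\Omega_{\mathcal{E}}\times\mathbb{R}^p_+$ is a KKT pair up to $\mathcal{E}$ of (RMP) if $0\in\sum_{i\in I}[\partial f_i^L(z)+\partial f_i^U(z)]+\sum_{j\in J}\lambda_j\,\mathrm{co}\{\partial_x g_j(z,v_j): v_j\in\mathcal{V}_j(z)\}+N(z;S)+\sqrt{\theta}\,\mathbb{B}$; $\lambda_j>0$ for all $j\in J$ with $0<g_j(z)\le\sqrt\theta$; and $\lambda_j=0$ if $g_j(z)\le0$. Dual problem (RMD) with respect to a KKT pair $(z_{\mathcal{E}},\lambda_{\mathcal{E}})$, $\lambda_{\mathcal{E}}=(\lambda_{1\mathcal{E}},\ldots,\lambda_{p\mathcal{E}})$: maximize (in the order $\le_{LU}$ componentwise) $L(y,\lambda)=(L_1(y,\lambda),\ldots,L_m(y,\lambda))$, where $L_i(y,\lambda)=[L_i^L(y,\lambda),L_i^U(y,\lambda)]$, $L_i^L(y,\lambda)=f_i^L(y)+\frac1{2m}\sum_{j\in J}\lambda_jg_j(y)$, $L_i^U(y,\lambda)=f_i^U(y)+\frac1{2m}\sum_{j\in J}\lambda_jg_j(y)$, over the set $\Omega_D$ of all $(y,\lambda)\in S\times\mathbb{R}^p_+$ such that $0\in\sum_{i\in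 I}[\partial f_i^L(y)+\partial f_i^U(y)]+\sum_{j\in J}\lambda_j\,\mathrm{co}\{\partial_xg_j(y,v_j):v_j\in\mathcal{V}_j(y)\}+N(y;S)+\sqrt\theta\,\mathbb{B}$ and $\lambda_j\le\lambda_{j\mathcal{E}}$ for all $j\in J(\mathcal{E}):=\{j\in J:0<g_j(z_{\mathcal{E}})\le\sqrt\theta\}$. $(\bar y,\bar\lambda)\in\Omega_D$ is an $\mathcal{E}$-quasi Pareto solution of (RMD) if there is no $(y,\lambda)\in\Omega_D$ such that $L_i(y,\lambda)-\frac{\mathcal{E}_i}{\sqrt\theta}\|y-\bar y\|\ge_{LU}L_i(\bar y,\bar\lambda)$ for all $i\in I$, with at least one of these inequalities strict (i.e. with $>_{LU}$). $(f,g)$ is generalized convex on $S$ at $z\in S$ if for any $x\in S$, $z_i^{*L}\in\partial f_i^L(z)$, $z_i^{*U}\in\partial f_i^U(z)$, $i\in I$, and $x^*_{v_j}\in\partial_x g_j(z,v_j)$, $v_j\in\mathcal{V}_j(z)$, $j\in J$, there exists $\omega\in[N(z;S)]^\circ$ satisfying: $f_i^L(x)-f_i^L(z)\ge\langle z_i^{*L},\omega\rangle$ and $f_i^U(x)-f_i^U(z)\ge\langle z_i^{*U},\omega\rangle$ for all $i\in I$; $g_j(x,v_j)-g_j(z,v_j)\ge\langle x^*_{v_j},\omega\rangle$ for $v_j\in\mathcal{V}_j(z)$, $j\in J$; and $\langle b^*,\omega\rangle\le\|x-z\|$ for all $b^*\in\mathbb{B}$.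
   Formalization: Generalized convexity is taken with one ω serving any finite set of subgradients of g_j(·,v_j) at each active v_j, not just one x*_{v_j} per v_j; with one per v_j the claim fails (S=ℝ, f=0, g=K(1−|x|)²+δ, 0<δ≤√θ<K). *)

(* Defs.v *)
From HB Require Import structures.
From mathcomp Require Import all_boot all_order all_algebra.
From mathcomp Require Import all_classical all_reals all_analysis.
Set Implicit Arguments.
Unset Strict Implicit.
Unset Printing Implicit Defensive.
Import Order.TTheory GRing.Theory Num.Theory.
Import numFieldNormedType.Exports.
Local Open Scope classical_set_scope.
Local Open Scope ring_scope.

(* R^n is 'rV[R]_n. The library norm `|x| on it is the sup norm, hence the
   Euclidean norm below; both induce the library topology. *)

Definition dotp (R : realType) (n : nat) (u v : 'rV[R]_n) : R :=
  \sum_(i < n) u 0 i * v 0 i.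

Definition enorm (R : realType) (n : nat) (u : 'rV[R]_n) : R :=
  Num.sqrt (dotp u u).

Definition eball (R : realType) (n : nat) (x : 'rV[R]_n) (r : R) :
    set 'rV[R]_n := [set y | enorm (y - x) < r].

Definition eunit_ball (R : realType) (n : nat) : set 'rV[R]_n :=
  [set b | enorm b <= 1].

Definition polar (R : realType) (n : nat) (C : set 'rV[R]_n) : set 'rV[R]_n :=
  [set w | forall x, C x -> dotp w x <= 0].

Definition cohull (R : realType) (n : nat) (A : set 'rV[R]_n) : set 'rV[R]_n :=
  smallest (@convex_set R 'rV[R]_n) A.

Definition elipschitz_on (R : realType) (n : nat) (k : R) (A : set 'rV[R]_n)
    (phi : 'rV[R]_n -> R) : Prop :=
  forall x y, A x -> A y -> `|phi x - phi y| <= k * enorm (x - y).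

Definition elocally_lipschitz (R : realType) (n : nat)
    (phi : 'rV[R]_n -> R) : Prop :=
  forall x, exists2 r : R, 0 < r &
    exists k : R, elipschitz_on k (eball x r) phi.

Definition usc_on (R : realType) (n : nat) (A : set 'rV[R]_n)
    (phi : 'rV[R]_n -> R) : Prop :=
  forall v0, A v0 -> forall e : R, 0 < e ->
    \forall v \near within A (nbhs v0), phi v < phi v0 + e.

(* The set of e-normals to A at x:
   limsup <xs, u - x> / ||u - x|| <= e as u -> x with u in A, u <> x
   (the limsup is -oo when x is isolated in A). *)
Definition eps_normals (R : realType) (n : nat) (e : R) (A : set 'rV[R]_n)
    (x : 'rV[R]_n) : set 'rV[R]_n :=
  [set xs | (limf_esup (fun u : 'rV[R]_n => (dotp xs (u - x) / enorm (u - x))%:E)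
               (within (A `\ x) (nbhs x)) <= e%:E)%E].

(* The limiting (Mordukhovich) normal cone: the sequential outer limit of the
   e-normals as u -> x in A and e -> 0+. *)
Definition ncone (R : realType) (n : nat) (A : set 'rV[R]_n) (x : 'rV[R]_n) :
    set 'rV[R]_n :=
  [set xs | A x /\
    exists (u : nat -> 'rV[R]_n) (e : nat -> R) (us : nat -> 'rV[R]_n),
      [/\ forall k, A (u k) /\ 0 <= e k,
          forall k, eps_normals (e k) A (u k) (us k),
          u k @[k --> \oo] --> x,
          e k @[k --> \oo] --> 0
        & us k @[k --> \oo] --> xs]].

(* R^n x R is encoded as 'rV[R]_(n + 1). *)
Definition pt_of (R : realType) (n : nat) (x : 'rV[R]_n) (t : R) :
    'rV[R]_(n + 1) := row_mx x t%:M.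

Definition epigraph (R : realType) (n : nat) (phi : 'rV[R]_n -> R) :
    set 'rV[R]_(n + 1) :=
  [set w | exists x t, w = pt_of x t /\ phi x <= t].

(* The limiting (Mordukhovich) subdifferential. *)
Definition lsubdiff (R : realType) (n : nat) (phi : 'rV[R]_n -> R)
    (x : 'rV[R]_n) : set 'rV[R]_n :=
  [set xs | ncone (epigraph phi) (pt_of x (phi x)) (pt_of xs (-1))].

(* The interval [a^L, a^U] is the pair (a^L, a^U). *)
Definition intv (R : realType) : Type := (R * R)%type.

Definition isub (R : realType) (A B : intv R) : intv R :=
  (A.1 - B.2, A.2 - B.1).

(* Meant for k >= 0. *)
Definition iscale (R : realType) (k : R) (A : intv R) : intv R :=
  (k * A.1, k * A.2).

Definition ige (R : realType) (A B : intv R) : Prop :=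
  B.1 <= A.1 /\ B.2 <= A.2.

Definition igt (R : realType) (A B : intv R) : Prop := ige A B /\ A <> B.

Definition lend (R : realType) (n : nat) (F : 'rV[R]_n -> intv R) :
    'rV[R]_n -> R := fun x => (F x).1.

Definition uend (R : realType) (n : nat) (F : 'rV[R]_n -> intv R) :
    'rV[R]_n -> R := fun x => (F x).2.

(* g_j(x) = max over V_j of g_j(x, .); under gj_standing and compactness of
   V_j the supremum is attained. *)
Definition gmax (R : realType) (n d : nat) (V : set 'rV[R]_d)
    (g : 'rV[R]_n -> 'rV[R]_d -> R) (x : 'rV[R]_n) : R :=
  sup [set g x v | v in V].

Definition active (R : realType) (n d : nat) (V : set 'rV[R]_d)
    (g : 'rV[R]_n -> 'rV[R]_d -> R) (x : 'rV[R]_n) : set 'rV[R]_d :=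
  [set v | V v /\ g x v = gmax V g x].

Definition psubdiff (R : realType) (n d : nat)
    (g : 'rV[R]_n -> 'rV[R]_d -> R) (x : 'rV[R]_n) (v : 'rV[R]_d) :
    set 'rV[R]_n :=
  lsubdiff (fun x' => g x' v) x.

Definition gj_standing (R : realType) (n d : nat) (V : set 'rV[R]_d)
    (g : 'rV[R]_n -> 'rV[R]_d -> R) : Prop :=
  forall xbar : 'rV[R]_n, exists2 delta : R, 0 < delta &
    [/\ forall x, eball xbar delta x -> usc_on V (g x),
        exists K : R, forall v, V v ->
          elipschitz_on K (eball xbar delta) (fun x => g x v)
      & forall vbar, active V g xbar vbar ->
        forall (x : nat -> 'rV[R]_n) (v : nat -> 'rV[R]_d)
               (xs : nat -> 'rV[R]_n) (xsbar : 'rV[R]_n),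
          (forall k, [/\ eball xbar delta (x k), V (v k)
                       & psubdiff g (x k) (v k) (xs k)]) ->
          x k @[k --> \oo] --> xbar ->
          v k @[k --> \oo] --> vbar ->
          xs k @[k --> \oo] --> xsbar ->
          psubdiff g xbar vbar xsbar].

Definition theta (R : realType) (m : nat) (E : 'I_m -> intv R) : R :=
  \sum_(i < m) ((E i).1 + (E i).2).

Definition feasE (R : realType) (n m p : nat) (d : 'I_p -> nat)
    (S : set 'rV[R]_n) (V : forall j, set 'rV[R]_(d j))
    (g : forall j, 'rV[R]_n -> 'rV[R]_(d j) -> R)
    (E : 'I_m -> intv R) : set 'rV[R]_n :=
  [set x | S x /\ forall j, gmax (V j) (g j) x <= Num.sqrt (theta E)].

(* 0 belongs to
   sum_i [df_i^L(z) + df_i^U(z)] + sum_j lam_j co {d_x g_j(z, v) : v active}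
   + N(z; S) + sqrt(theta) B. *)
Definition stationary (R : realType) (n m p : nat) (d : 'I_p -> nat)
    (S : set 'rV[R]_n) (f : 'I_m -> 'rV[R]_n -> intv R)
    (V : forall j, set 'rV[R]_(d j))
    (g : forall j, 'rV[R]_n -> 'rV[R]_(d j) -> R)
    (E : 'I_m -> intv R) (z : 'rV[R]_n) (lam : 'rV[R]_p) : Prop :=
  exists (zL zU : 'I_m -> 'rV[R]_n) (c : 'I_p -> 'rV[R]_n) (eta b : 'rV[R]_n),
    [/\ forall i, lsubdiff (lend (f i)) z (zL i) /\
                  lsubdiff (uend (f i)) z (zU i),
        forall j, cohull (\bigcup_(v in active (V j) (g j) z)
                            psubdiff (g j) z v) (c j),
        ncone S z eta,
        @eunit_ball R n b
      & 0 = \sum_(i < m) (zL i + zU i) + \sum_(j < p) lam 0 j *: c j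
            + eta + Num.sqrt (theta E) *: b].

Definition KKT_pair (R : realType) (n m p : nat) (d : 'I_p -> nat)
    (S : set 'rV[R]_n) (f : 'I_m -> 'rV[R]_n -> intv R)
    (V : forall j, set 'rV[R]_(d j))
    (g : forall j, 'rV[R]_n -> 'rV[R]_(d j) -> R)
    (E : 'I_m -> intv R) (z : 'rV[R]_n) (lam : 'rV[R]_p) : Prop :=
  [/\ feasE S V g E z,
      forall j, 0 <= lam 0 j,
      stationary S f V g E z lam,
      forall j, 0 < gmax (V j) (g j) z <= Num.sqrt (theta E) -> 0 < lam 0 j
    & forall j, gmax (V j) (g j) z <= 0 -> lam 0 j = 0].

Definition dual_obj (R : realType) (n m p : nat) (d : 'I_p -> nat)
    (f : 'I_m -> 'rV[R]_n -> intv R)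
    (V : forall j, set 'rV[R]_(d j))
    (g : forall j, 'rV[R]_n -> 'rV[R]_(d j) -> R)
    (i : 'I_m) (y : 'rV[R]_n) (lam : 'rV[R]_p) : intv R :=
  let pen := (2 * m%:R)^-1 * \sum_(j < p) lam 0 j * gmax (V j) (g j) y in
  (lend (f i) y + pen, uend (f i) y + pen).

Definition dual_feas (R : realType) (n m p : nat) (d : 'I_p -> nat)
    (S : set 'rV[R]_n) (f : 'I_m -> 'rV[R]_n -> intv R)
    (V : forall j, set 'rV[R]_(d j))
    (g : forall j, 'rV[R]_n -> 'rV[R]_(d j) -> R)
    (E : 'I_m -> intv R) (zE : 'rV[R]_n) (lamE : 'rV[R]_p)
    (y : 'rV[R]_n) (lam : 'rV[R]_p) : Prop :=
  [/\ S y,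
      forall j, 0 <= lam 0 j,
      stationary S f V g E y lam
    & forall j, 0 < gmax (V j) (g j) zE <= Num.sqrt (theta E) ->
        lam 0 j <= lamE 0 j].

Definition dual_quasi_pareto (R : realType) (n m p : nat) (d : 'I_p -> nat)
    (S : set 'rV[R]_n) (f : 'I_m -> 'rV[R]_n -> intv R)
    (V : forall j, set 'rV[R]_(d j))
    (g : forall j, 'rV[R]_n -> 'rV[R]_(d j) -> R)
    (E : 'I_m -> intv R) (zE : 'rV[R]_n) (lamE : 'rV[R]_p)
    (ybar : 'rV[R]_n) (lambar : 'rV[R]_p) : Prop :=
  let shifted i y lam :=
    isub (dual_obj f V g i y lam)
         (iscale (enorm (y - ybar)) (iscale (Num.sqrt (theta E))^-1 (E i))) in
  dual_feas S f V g E zE lamE ybar lambar /\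
  ~ exists (y : 'rV[R]_n) (lam : 'rV[R]_p),
      [/\ dual_feas S f V g E zE lamE y lam,
          forall i, ige (shifted i y lam) (dual_obj f V g i ybar lambar)
        & exists i, igt (shifted i y lam) (dual_obj f V g i ybar lambar)].

(* Pitfall: the limiting subdifferential is not convex, so an element of
   co {d_x g_j(z, v) : v active} may mix several subgradients at one and the
   same v. Accordingly the prescribed collection of subgradients x*_v may
   contain finitely many of them, X j v, at each active v; singletons X j v
   are the case of one subgradient per v. *)
Definition gen_convex_at (R : realType) (n m p : nat) (d : 'I_p -> nat)
    (S : set 'rV[R]_n) (f : 'I_m -> 'rV[R]_n -> intv R)
    (V : forall j, set 'rV[R]_(d j))
    (g : forall j, 'rV[R]_n -> 'rV[R]_(d j) -> R) (z : 'rV[R]_n) : Prop :=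
  forall (x : 'rV[R]_n) (zL zU : 'I_m -> 'rV[R]_n)
         (X : forall j : 'I_p, 'rV[R]_(d j) -> set 'rV[R]_n),
    S x ->
    (forall i, lsubdiff (lend (f i)) z (zL i)) ->
    (forall i, lsubdiff (uend (f i)) z (zU i)) ->
    (forall j v, active (V j) (g j) z v ->
       finite_set (X j v) /\ X j v `<=` psubdiff (g j) z v) ->
    exists w : 'rV[R]_n,
      [/\ polar (ncone S z) w,
          forall i, dotp (zL i) w <= lend (f i) x - lend (f i) z /\
                    dotp (zU i) w <= uend (f i) x - uend (f i) z,
          forall j v, active (V j) (g j) z v -> forall xs, X j v xs ->
            dotp xs w <= g j x v - g j z v
        & forall b, @eunit_ball R n b -> dotp b w <= enorm (x - z)].

(* Main.v *)
Require Import Defs.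
From mathcomp Require Import all_boot all_order all_algebra.
From mathcomp Require Import all_classical all_reals all_analysis.
From mathcomp Require Import ring lra.
Set Implicit Arguments.
Unset Strict Implicit.
Unset Printing Implicit Defensive.
Import Order.TTheory GRing.Theory Num.Theory.
Import numFieldNormedType.Exports.
Local Open Scope classical_set_scope.
Local Open Scope ring_scope.

(** The theorem is a weak duality statement. Write t = sqrt theta and let
    (y, lam) be dual feasible. Stationarity at y writes 0 as a sum of
    subgradients, normals and t b with b in the unit ball. Pairing this sum
    with the direction w that generalized convexity provides at y for the
    target z = zE bounds every subgradient term by a difference of function
    values, makes the normal term nonpositive (w lies in the polar cone) and
    costs at most t ||z - y|| for the ball term ([weak_duality]):
      sum (f^L + f^U)(y) + sum_j lam_j g_j(y)
        <= sum (f^L + f^U)(z) + sum_j lam_j g_j(z) + t ||z - y||.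
    Replacing lam_j by lamE_j on the right can only increase the bound: where
    g_j(z) > 0 dual feasibility gives lam_j <= lamE_j, and where g_j(z) <= 0
    complementarity gives lamE_j = 0 ([multiplier_exchange]).

    Hence, if (y, lam) improved on (zE, lamE) in the quasi-Pareto sense,
    adding the 2m endpoint inequalities would contradict this bound: the
    weights 1/(2m) reassemble the penalty sum, the endpoints of the E_i add up
    to theta = t^2, so that the perturbation is exactly
    theta / t ||y - z|| = t ||y - z||, and one inequality is strict
    ([endpoint_sum_lt], [endpoint_sum_isub_iscale],
    [endpoint_sum_dual_obj]).

    Generalized convexity speaks about finitely many subgradients at each
    active parameter, whereas stationarity involves convex hulls; the two are
    matched by [cohull_finite_support]: a linear functional at a point of a
    hull is bounded by its bound on finitely many generators. *)

(** * Euclidean pairing and norm *)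

Lemma dotpDl (R : realType) (n : nat) (u v w : 'rV[R]_n) :
  dotp (u + v) w = dotp u w + dotp v w.
Proof.
rewrite /dotp -big_split /=; apply: eq_bigr => i _.
by rewrite mxE mulrDl.
Qed.

Lemma dotpZl (R : realType) (n : nat) (k : R) (u w : 'rV[R]_n) :
  dotp (k *: u) w = k * dotp u w.
Proof.
rewrite /dotp mulr_sumr; apply: eq_bigr => i _.
by rewrite mxE mulrA.
Qed.

Lemma dotp0l (R : realType) (n : nat) (w : 'rV[R]_n) : dotp 0 w = 0.
Proof. by rewrite /dotp big1 // => i _; rewrite mxE mul0r. Qed.

Lemma dotp_suml (R : realType) (n k : nat) (F : 'I_k -> 'rV[R]_n)
    (w : 'rV[R]_n) :
  dotp (\sum_(i < k) F i) w = \sum_(i < k) dotp (F i) w.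
Proof.
apply: (big_morph (fun u => dotp u w)); last exact: dotp0l.
by move=> u v; exact: dotpDl.
Qed.

Lemma dotpC (R : realType) (n : nat) (u v : 'rV[R]_n) : dotp u v = dotp v u.
Proof. by rewrite /dotp; apply: eq_bigr => i _; rewrite mulrC. Qed.

Lemma enorm_distC (R : realType) (n : nat) (x y : 'rV[R]_n) :
  enorm (x - y) = enorm (y - x).
Proof.
rewrite /enorm /dotp; congr Num.sqrt; apply: eq_bigr => i _.
by rewrite !mxE; ring.
Qed.

Lemma eball_center (R : realType) (n : nat) (x : 'rV[R]_n) (r : R) :
  0 < r -> eball x r x.
Proof. by rewrite /eball /= subrr /enorm dotp0l sqrtr0. Qed.

(** * The worst-case constraint function *)

(** Compactness turns the local bound phi < phi v0 + 1, valid near each v0,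
    into a uniform one: the inequality phi v <= M holds for v near v0 and M
    large, hence on all of A for M large. *)
Lemma usc_on_compact_bounded (R : realType) (n : nat) (A : set 'rV[R]_n)
    (phi : 'rV[R]_n -> R) :
  compact A -> usc_on A phi -> has_ubound [set phi v | v in A].
Proof.
move=> /compact_near_coveringP/near_covering_withinP Acov Ausc.
have : \forall M \near +oo, A `<=` [set v | phi v <= M].
  apply: Acov => v0 Av0.
  exists ([set v | A v -> phi v < phi v0 + 1], [set M | phi v0 + 1 <= M]) => /=.
    by split; [exact: Ausc | apply: nbhs_pinfty_ge; exact: num_real].
  move=> [v M] /= [phiv leM] Av; apply/ltW.
  exact: lt_le_trans (phiv Av) leM.
move=> /filter_ex[M AM].
by exists M => _ [v Av <-]; exact: AM.
Qed.

(** The supremum of an unbounded set is a junk value, so this is where upper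
    semicontinuity and compactness enter. *)
Lemma gmax_ge (R : realType) (n d : nat) (V : set 'rV[R]_d)
    (g : 'rV[R]_n -> 'rV[R]_d -> R) (x : 'rV[R]_n) (v : 'rV[R]_d) :
  compact V -> gj_standing V g -> V v -> g x v <= gmax V g x.
Proof.
move=> Vcompact gstd Vv; have [r r0 [gusc _ _]] := gstd x.
apply: ub_le_sup; last by exists v.
exact/usc_on_compact_bounded/gusc/eball_center.
Qed.

(** * Convex hulls *)

(** The points c with such a finite support F form a convex set containing A:
    for a convex combination of two of them take the union of the supports.
    The support does not depend on the functional w, which is essential, since
    generalized convexity chooses w after the subgradients. *)
Lemma cohull_finite_support (R : realType) (n : nat) (A : set 'rV[R]_n)
    (c : 'rV[R]_n) :
  cohull A c ->
  exists F : set 'rV[R]_n, [/\ finite_set F, F `<=` A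
    & forall w a, (forall x, F x -> dotp x w <= a) -> dotp c w <= a].
Proof.
pose C := [set c : 'rV[R]_n | exists F : set 'rV[R]_n,
  [/\ finite_set F, F `<=` A
    & forall w a, (forall x, F x -> dotp x w <= a) -> dotp c w <= a]].
suff : cohull A `<=` C by exact.
apply: smallest_sub => [x y k|x Ax]; last first.
  exists [set x]; split=> [|_ -> //|w a]; first exact: finite_set1.
  exact.
rewrite !inE => -[Fx [Fxfin FxA Fxc]] [Fy [Fyfin FyA Fyc]].
exists (Fx `|` Fy); split; first by rewrite finite_setU.
  by move=> z [/FxA|/FyA].
move=> w a Fle.
have xa : dotp x w <= a by apply: Fxc => z Fz; apply: Fle; left.
have ya : dotp y w <= a by apply: Fyc => z Fz; apply: Fle; right.
rewrite -[conv k x y]/(k%:num *: x + (1 - k%:num) *: y).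
have k0 : 0 <= k%:num by [].
have k1 : k%:num <= 1 by [].
by rewrite dotpDl !dotpZl; nra.
Qed.

(** * Weak duality *)

(** Both sides evaluate one Lagrangian, with the multipliers lam that make y
    stationary; generalized convexity makes y a global minimizer of it over S up
    to the ball term. *)
Lemma weak_duality (R : realType) (n m p : nat) (d : 'I_p -> nat)
    (S : set 'rV[R]_n) (f : 'I_m -> 'rV[R]_n -> intv R)
    (V : forall j : 'I_p, set 'rV[R]_(d j))
    (g : forall j : 'I_p, 'rV[R]_n -> 'rV[R]_(d j) -> R)
    (E : 'I_m -> intv R) (x y : 'rV[R]_n) (lam : 'rV[R]_p) :
  (forall j, compact (V j)) -> (forall j, gj_standing (V j) (g j)) ->
  gen_convex_at S f V g y -> S x ->
  (forall j, 0 <= lam 0 j) -> stationary S f V g E y lam ->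
  \sum_(i < m) (lend (f i) y + uend (f i) y)
    + \sum_(j < p) lam 0 j * gmax (V j) (g j) y <=
  \sum_(i < m) (lend (f i) x + uend (f i) x)
    + \sum_(j < p) lam 0 j * gmax (V j) (g j) x
    + Num.sqrt (theta E) * enorm (x - y).
Proof.
move=> Vcompact gstd fg_y Sx lam_ge0 [zL [zU [c [eta [b]]]]].
case=> zLU c_co eta_N b_ball sum0.
have /choice[F Fspec] j := cohull_finite_support (c_co j).
(* The collection of subgradients submitted to generalized convexity: those
   elements of the finite support of c j that are subgradients at v. *)
have [| | |w [w_polar w_f w_g w_b]] := fg_y x zL zU
  (fun j v => F j `&` psubdiff (g j) y v) Sx.
- by move=> i; have [] := zLU i.
- by move=> i; have [] := zLU i.
- move=> j v _; split; last exact: subIsetr.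
  by apply: sub_finite_set (@subIsetl _ _ _) _; have [] := Fspec j.
have c_le j : dotp (c j) w <= gmax (V j) (g j) x - gmax (V j) (g j) y.
  have [_ FA] := Fspec j; apply => xs Fxs.
  have [v act_v sub_v] := FA _ Fxs.
  (* v is active at y but maybe not at x, whence the inequality gmax_ge. *)
  have := w_g j v act_v xs (conj Fxs sub_v).
  have [Vv ->] := act_v => /le_trans; apply.
  by rewrite lerD2r; exact: gmax_ge.
have eta_le : dotp eta w <= 0 by rewrite dotpC; exact: w_polar.
have b_le : Num.sqrt (theta E) * dotp b w
    <= Num.sqrt (theta E) * enorm (x - y).
  by rewrite ler_wpM2l ?sqrtr_ge0 ?w_b.
have f_le : \sum_(i < m) dotp (zL i + zU i) w <=
    \sum_(i < m) (lend (f i) x + uend (f i) x)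
    - \sum_(i < m) (lend (f i) y + uend (f i) y).
  rewrite -sumrB; apply: ler_sum => i _; rewrite dotpDl.
  by have [] := w_f i; lra.
have g_le : \sum_(j < p) dotp (lam 0 j *: c j) w <=
    \sum_(j < p) lam 0 j * gmax (V j) (g j) x
    - \sum_(j < p) lam 0 j * gmax (V j) (g j) y.
  rewrite -sumrB; apply: ler_sum => j _.
  by rewrite dotpZl -mulrBr ler_wpM2l.
have := congr1 (fun u => dotp u w) sum0.
rewrite dotp0l !dotpDl !dotp_suml dotpZl.
lra.
Qed.

(** The exchange holds because lamE is complementary to G at the reference
    point: G j <= 0 forces lamE j = 0, and then lam j * G j <= 0. *)
Lemma multiplier_exchange (R : realType) (p : nat) (lam lamE : 'rV[R]_p)
    (G : 'I_p -> R) :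
  (forall j, 0 <= lam 0 j) ->
  (forall j, 0 < G j -> lam 0 j <= lamE 0 j) ->
  (forall j, G j <= 0 -> lamE 0 j = 0) ->
  \sum_(j < p) lam 0 j * G j <= \sum_(j < p) lamE 0 j * G j.
Proof.
move=> lam_ge0 lam_le lamE_eq0; apply: ler_sum => j _.
have [G_le0|G_gt0] := leP (G j) 0.
  by rewrite lamE_eq0 // mul0r mulr_ge0_le0.
by rewrite ler_wpM2r ?lam_le // ltW.
Qed.

(** * Summing interval inequalities *)

Definition endpoint_sum (R : realType) (m : nat) (A : 'I_m -> intv R) : R :=
  \sum_(i < m) ((A i).1 + (A i).2).

(** For comparable intervals, being distinct means that one of the two endpoint
    inequalities is strict. *)
Lemma endpoint_sum_lt (R : realType) (m : nat) (A B : 'I_m -> intv R) :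
  (forall i, ige (A i) (B i)) -> (exists i, igt (A i) (B i)) ->
  endpoint_sum B < endpoint_sum A.
Proof.
move=> geAB [i0 [_ neqAB]].
rewrite /endpoint_sum !(bigD1 i0 (P := predT)) //=; apply: ltr_leD; last first.
  by apply: ler_sum => i _; have [] := geAB i; lra.
have [ge1 ge2] := geAB i0.
rewrite lt_neqAle lerD // andbT; apply/eqP => eq_sum; apply: neqAB.
by rewrite [LHS]surjective_pairing [RHS]surjective_pairing; congr pair; lra.
Qed.

(** Interval subtraction swaps the endpoints of the subtrahend, which is
    invisible to the sum of the two endpoints. *)
Lemma endpoint_sum_isub_iscale (R : realType) (m : nat) (A E : 'I_m -> intv R)
    (k s : R) :
  endpoint_sum (fun i => isub (A i) (iscale k (iscale s (E i)))) =
  endpoint_sum A - k * (s * theta E).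
Proof.
rewrite /endpoint_sum /theta !mulr_sumr -sumrB; apply: eq_bigr => i _ /=.
ring.
Qed.

(** The weight 1/(2m) is chosen for this: the penalty is spread evenly over the
    2m endpoints. *)
Lemma endpoint_sum_dual_obj (R : realType) (n m p : nat) (d : 'I_p -> nat)
    (f : 'I_m -> 'rV[R]_n -> intv R)
    (V : forall j, set 'rV[R]_(d j))
    (g : forall j, 'rV[R]_n -> 'rV[R]_(d j) -> R)
    (y : 'rV[R]_n) (lam : 'rV[R]_p) :
  (0 < m)%N ->
  endpoint_sum (fun i => dual_obj f V g i y lam) =
  \sum_(i < m) (lend (f i) y + uend (f i) y)
    + \sum_(j < p) lam 0 j * gmax (V j) (g j) y.
Proof.
move=> m_gt0; rewrite /endpoint_sum /dual_obj /=.
set P := \sum_(j < p) _.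
under eq_bigr do rewrite addrACA.
rewrite big_split /= sumr_const card_ord -mulr_natr; congr (_ + _).
by field; rewrite pnatr_eq0 -lt0n.
Qed.

Theorem theorem4p1 (R : realType) (n m p : nat) (d : 'I_p -> nat)
    (S : set 'rV[R]_n) (f : 'I_m -> 'rV[R]_n -> intv R)
    (V : forall j : 'I_p, set 'rV[R]_(d j))
    (g : forall j : 'I_p, 'rV[R]_n -> 'rV[R]_(d j) -> R)
    (E : 'I_m -> intv R) (zE : 'rV[R]_n) (lamE : 'rV[R]_p)
    (S_neq0 : S !=set0) (S_closed : closed S)
    (f_intv : forall i x, lend (f i) x <= uend (f i) x)
    (fL_lip : forall i, elocally_lipschitz (lend (f i)))
    (fU_lip : forall i, elocally_lipschitz (uend (f i)))
    (V_neq0 : forall j, V j !=set0) (V_compact : forall j, compact (V j))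
    (g_standing : forall j, gj_standing (V j) (g j))
    (E_intv : forall i, 0 <= (E i).1 /\ (E i).1 <= (E i).2)
    (theta_gt0 : 0 < theta E)
    (zE_KKT : KKT_pair S f V g E zE lamE)
    (fg_gen_convex : forall y, S y -> gen_convex_at S f V g y) :
  dual_quasi_pareto S f V g E zE lamE zE lamE.
Proof.
have [[S_zE g_zE] lamE_ge0 statE _ lamE_eq0] := zE_KKT.
split; first by split.
move=> [y [lam [[Sy lam_ge0 stat_y lam_le] shift_ge shift_gt]]].
have := endpoint_sum_lt shift_ge shift_gt.
have m_gt0 : (0 < m)%N.
  by have [i _] := shift_gt; exact: leq_ltn_trans (ltn_ord i).
rewrite endpoint_sum_isub_iscale !endpoint_sum_dual_obj //.
have -> : (Num.sqrt (theta E))^-1 * theta E = Num.sqrt (theta E).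
  by rewrite -[X in _ * X](sqr_sqrtr (ltW theta_gt0)) expr2 mulKf //
    gt_eqF // sqrtr_gt0.
have lam_le_pos j : 0 < gmax (V j) (g j) zE -> lam 0 j <= lamE 0 j.
  by move=> g_gt0; apply: lam_le; rewrite g_gt0 g_zE.
have exch := multiplier_exchange lam_ge0 lam_le_pos lamE_eq0.
have := weak_duality
  V_compact g_standing (fg_gen_convex _ Sy) S_zE lam_ge0 stat_y.
rewrite (enorm_distC zE y).
lra.
Qed.
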